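(* For every $\gamma,\delta>1$ there exists a constant $C>0$ depending only on $\gamma$ and $\delta$ such that the following holds. Let $0<\mu_x\le L_x$, $0<\mu_y\le L_y$, $L_{xy}\ge0$, let $f\in\mathcal F(\mu_x,\mu_y,L_x,L_y,L_{xy})$, and run Alex-GDA on $f$ (from any initialization) with parameters $\gamma,\delta$ and step sizes $\alpha,\beta>0$ that satisfy $$\alpha\le C\min\left\{\frac1{L_x},\frac{\sqrt{\mu_y}}{L_{xy}\sqrt{\mu_x}}\right\},\qquad \beta\le C\min\left\{\frac1{L_y},\frac{\sqrt{\mu_x}}{L_{xy}\sqrt{\mu_y}}\right\}.$$ Then $\Psi^{\mathrm{Alex}}_k$ is valid, i.e. there is a constant $A>0$ with $\Psi^{\mathrm{Alex}}_k\ge A\|z_k-z_\star\|^2$ for all $k$, and $\Psi^{\mathrm{Alex}}_{k+1}\le r\,\Psi^{\mathrm{Alex}}_k$ for all $k\ge0$ with $$r=\max\{1-\alpha\mu_x,\ 1-\beta\mu_y\}.$$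
   Context: Function class. For $0<\mu_x\le L_x$, $0<\mu_y\le L_y$, $L_{xy}\ge0$, $\mathcal F(\mu_x,\mu_y,L_x,L_y,L_{xy})$ is the set of all twice-differentiable $f:\mathbb R^{d_x}\times\mathbb R^{d_y}\to\mathbb R$ (any $d_x,d_y$) such that: (i) $f(\cdot,y)$ is $\mu_x$-strongly convex for every $y$ and $f(x,\cdot)$ is $\mu_y$-strongly concave for every $x$ ($g$ is $\mu$-strongly convex if $g(z')\ge g(z)+\langle\nabla g(z),z'-z\rangle+\frac\mu2\|z'-z\|^2$ for all $z,z'$; $g$ is $\mu$-strongly concave if $-g$ is $\mu$-strongly convex); (ii) for all $x,x',y,y'$: $\|\nabla_xf(x',y)-\nabla_xf(x,y)\|\le L_x\|x'-x\|$, $\|\nabla_yf(x,y')-\nabla_yf(x,y)\|\le L_y\|y'-y\|$, $\|\nabla_xf(x,y')-\nabla_xf(x,y)\|\le L_{xy}\|y'-y\|$, $\|\nabla_yf(x',y)-\nabla_yf(x,y)\|\le L_{xy}\|x'-x\|$. Norms are Euclidean. Every such $f$ has a unique Nash equilibrium $z_\star=(x_\star,y_\star)$, i.e. a point with $f(x_\star,y)\le f(x_\star,y_\star)\le f(x,y_\star)$ for all $x,y$. Alex-GDA with step sizes $\alpha,\beta>0$ and parameters $\gamma,\delta\ge0$: start from $(x_0,y_0)$ with $\tilde y_0=y_0$, and for $k\ge0$: $x_{k+1}=x_k-\alpha\nabla_xf(x_k,\tilde y_k)$, $\tilde x_{k+1}=x_k-\gamma\alpha\nabla_xf(x_k,\tilde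 y_k)$, $y_{k+1}=y_k+\beta\nabla_yf(\tilde x_{k+1},y_k)$, $\tilde y_{k+1}=y_k+\delta\beta\nabla_yf(\tilde x_{k+1},y_k)$. Write $z_k=(x_k,y_k)$. Lyapunov function: with $V(x,y)=\frac1\alpha\|x-x_\star\|^2+\frac1\beta\|y-y_\star\|^2$, for $k\ge1$ $$\Psi^{\mathrm{Alex}}_k=V(x_k,y_k)+V(x_{k+1},y_k)-\alpha\|\nabla_xf(x_k,\tilde y_k)\|^2+(\delta-1)\beta\|\nabla_yf(\tilde x_k,y_{k-1})\|^2+\frac{(\gamma-1)(\delta-1)\alpha\beta}{1-\alpha\mu_x}L_{xy}\sqrt{\tfrac{\mu_y}{\mu_x}}\,\|\nabla_xf(x_{k-1},\tilde y_{k-1})\|^2,$$ and $$\Psi^{\mathrm{Alex}}_0=V(x_0,y_0)+V(x_1,y_0)-\alpha\|\nabla_xf(x_0,\tilde y_0)\|^2+\frac{(\gamma-1)(\delta-1)\alpha\beta}{(1-\alpha\mu_x)(1-\beta\mu_y)}L_{xy}\sqrt{\tfrac{\mu_y}{\mu_x}}\,\|\nabla_xf(x_0,\tilde y_0)\|^2 .$$ Convention: if $L_{xy}=0$, a fraction with $L_{xy}$ in the denominator is $+\infty$. *)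

(* Defs.v *)
From HB Require Import structures.
From mathcomp Require Import all_boot all_order all_algebra.
From mathcomp Require Import all_classical all_reals all_analysis.

Set Implicit Arguments.
Unset Strict Implicit.
Unset Printing Implicit Defensive.

Import Order.TTheory GRing.Theory Num.Theory.
Import numFieldNormedType.Exports.

Local Open Scope ring_scope.

(* The norm that the library puts on row vectors and on products is the sup
   norm. It is only used below through [differentiable], which does not depend
   on the choice of norm; every quantitative condition uses [enorm]. *)
Definition dotv (R : realType) (n : nat) (u v : 'rV[R]_n) : R :=
  \sum_(i < n) u 0 i * v 0 i.

Definition enorm (R : realType) (n : nat) (u : 'rV[R]_n) : R :=
  Num.sqrt (dotv u u).

Definition pair_enorm (R : realType) (m n : nat)
    (z : 'rV[R]_m * 'rV[R]_n) : R :=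
  Num.sqrt (enorm z.1 ^+ 2 + enorm z.2 ^+ 2).

Definition grad (R : realType) (n : nat) (g : 'rV[R]_n -> R^o) (z : 'rV[R]_n) :
    'rV[R]_n :=
  \row_(i < n) 'D_(delta_mx 0 i) g z.

Definition strongly_convex (R : realType) (n : nat) (mu : R)
    (g : 'rV[R]_n -> R^o) : Prop :=
  forall z z' : 'rV[R]_n,
    g z + dotv (grad g z) (z' - z) + mu / 2 * enorm (z' - z) ^+ 2 <= g z'.

Definition strongly_concave (R : realType) (n : nat) (mu : R)
    (g : 'rV[R]_n -> R^o) : Prop :=
  strongly_convex mu (fun z => - g z).

Section MinimaxProblem.
Variables (R : realType) (dx dy : nat).
Implicit Types (f : 'rV[R]_dx * 'rV[R]_dy -> R^o).

Definition gradx f (x : 'rV[R]_dx) (y : 'rV[R]_dy) : 'rV[R]_dx :=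
  grad (fun u => f (u, y)) x.

Definition grady f (x : 'rV[R]_dx) (y : 'rV[R]_dy) : 'rV[R]_dy :=
  grad (fun v => f (x, v)) y.

(* Fréchet differentiability of f and of its full gradient; continuity of the
   second derivative is not required. *)
Definition twice_differentiable f : Prop :=
  (forall z, differentiable f z) /\
  (forall z, differentiable
     (fun w : 'rV[R]_dx * 'rV[R]_dy => (gradx f w.1 w.2, grady f w.1 w.2)) z).

Record function_class (mux muy Lx Ly Lxy : R) f : Prop := FunctionClass {
  fc_twice_differentiable : twice_differentiable f;
  fc_strongly_convex : forall y, strongly_convex mux (fun x => f (x, y));
  fc_strongly_concave : forall x, strongly_concave muy (fun y => f (x, y));
  fc_smooth_xx : forall x x' y,
    enorm (gradx f x' y - gradx f x y) <= Lx * enorm (x' - x);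
  fc_smooth_yy : forall x y y',
    enorm (grady f x y' - grady f x y) <= Ly * enorm (y' - y);
  fc_smooth_xy : forall x y y',
    enorm (gradx f x y' - gradx f x y) <= Lxy * enorm (y' - y);
  fc_smooth_yx : forall x x' y,
    enorm (grady f x' y - grady f x y) <= Lxy * enorm (x' - x)
}.

Definition nash_equilibrium f (zs : 'rV[R]_dx * 'rV[R]_dy) : Prop :=
  forall x y, f (zs.1, y) <= f zs /\ f zs <= f (x, zs.2).

(* [xt] and [yt] are the sequences written with tildes; [xt 0] is not part of
   the algorithm and is left unconstrained. *)
Definition alex_gda f (alpha beta gamma delta : R)
    (x xt : nat -> 'rV[R]_dx) (y yt : nat -> 'rV[R]_dy) : Prop :=
  yt 0%N = y 0%N /\
  forall k : nat,
    [/\ x k.+1 = x k - alpha *: gradx f (x k) (yt k),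
        xt k.+1 = x k - (gamma * alpha) *: gradx f (x k) (yt k),
        y k.+1 = y k + beta *: grady f (xt k.+1) (y k)
      & yt k.+1 = y k + (delta * beta) *: grady f (xt k.+1) (y k)].

Definition lyapV (alpha beta : R) (zs : 'rV[R]_dx * 'rV[R]_dy)
    (x : 'rV[R]_dx) (y : 'rV[R]_dy) : R :=
  1 / alpha * enorm (x - zs.1) ^+ 2 + 1 / beta * enorm (y - zs.2) ^+ 2.

Definition psi_alex f (mux muy Lxy alpha beta gamma delta : R)
    (zs : 'rV[R]_dx * 'rV[R]_dy)
    (x xt : nat -> 'rV[R]_dx) (y yt : nat -> 'rV[R]_dy) (k : nat) : R :=
  let V := lyapV alpha beta zs in
  let base := V (x k) (y k) + V (x k.+1) (y k)
              - alpha * enorm (gradx f (x k) (yt k)) ^+ 2 in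
  match k with
  | 0 =>
      base
      + (gamma - 1) * (delta - 1) * alpha * beta
        / ((1 - alpha * mux) * (1 - beta * muy))
        * Lxy * Num.sqrt (muy / mux)
        * enorm (gradx f (x 0%N) (yt 0%N)) ^+ 2
  | j.+1 =>
      base
      + (delta - 1) * beta * enorm (grady f (xt k) (y j)) ^+ 2
      + (gamma - 1) * (delta - 1) * alpha * beta / (1 - alpha * mux)
        * Lxy * Num.sqrt (muy / mux)
        * enorm (gradx f (x j) (yt j)) ^+ 2
  end.

End MinimaxProblem.

(* Extended-real division satisfies r / 0 = +oo for r > 0, which is the intended
   value of a fraction with a vanishing coupling constant in the denominator. *)
Definition step_bound (R : realType) (C L mu mu' Lxy : R) : \bar R :=
  (C%:E * Order.min (1 / L)%:E
            ((Num.sqrt mu')%:E / (Lxy * Num.sqrt mu)%:E))%E.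

(* Main.v *)
(* The Lyapunov difference telescopes: with g, h the gradients used in step k and
   centred at the equilibrium,
     Psi_{k+1} - Psi_k = - 2 <g_k + g_{k+1}, x_{k+1}> + 2 <h_k, y_k + y_{k+1}>
                         + (delta - 1) b (|h_k|^2 - |h_{k-1}|^2) + K (|g_k|^2 - |g_{k-1}|^2).
   Strong convexity-concavity turns the inner products into values of f, whose
   differences f(xt_{k+1}, y_k) - f(x_{k+1}, yt_{k+1}) and
   f(xt_{k+1}, y_k) - f(x_k, yt_k) are again bounded by first-order convexity, since
   the extrapolations xt - x and yt - y are multiples of the same gradients. This
   yields - 4 (gamma - 1) a |g_k|^2 - (delta - 1) b |h_k|^2 - 3 (delta - 1) b |h_{k-1}|^2
   up to errors that the Lipschitz bounds make smaller by a factor C, together with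
   - 5/2 mux |x_k|^2 - 2 muy |y_k|^2, which pays for the contraction (1 - r) Psi_k. *)
Require Import Defs.
From HB Require Import structures.
From mathcomp Require Import all_boot all_order all_algebra.
From mathcomp Require Import all_classical all_reals all_analysis.
From mathcomp Require Import ring lra.

Import Order.TTheory GRing.Theory Num.Theory.
Import numFieldNormedType.Exports.

Set Implicit Arguments.
Unset Strict Implicit.

Local Open Scope ring_scope.

(** * Euclidean inner product and norm *)

Lemma dotvC {R : realType} {n} (u v : 'rV[R]_n) : dotv u v = dotv v u.
Proof. by apply: eq_bigr => i _; rewrite mulrC. Qed.

Lemma dotvDl {R : realType} {n} (u v w : 'rV[R]_n) :
  dotv (u + v) w = dotv u w + dotv v w.
Proof. by rewrite -big_split; apply: eq_bigr => i _; rewrite mxE mulrDl. Qed.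

Lemma dotvZl {R : realType} {n} (a : R) (u w : 'rV[R]_n) :
  dotv (a *: u) w = a * dotv u w.
Proof. by rewrite [RHS]big_distrr; apply: eq_bigr => i _; rewrite mxE /= mulrA. Qed.

Lemma dotvNl {R : realType} {n} (u w : 'rV[R]_n) : dotv (- u) w = - dotv u w.
Proof. by rewrite -scaleN1r dotvZl mulN1r. Qed.

Lemma dotvDr {R : realType} {n} (u v w : 'rV[R]_n) :
  dotv w (u + v) = dotv w u + dotv w v.
Proof. by rewrite dotvC dotvDl !(dotvC w). Qed.

Lemma dotvZr {R : realType} {n} (a : R) (u w : 'rV[R]_n) :
  dotv w (a *: u) = a * dotv w u.
Proof. by rewrite dotvC dotvZl dotvC. Qed.

Lemma dotvNr {R : realType} {n} (u w : 'rV[R]_n) : dotv w (- u) = - dotv w u.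
Proof. by rewrite dotvC dotvNl dotvC. Qed.

Definition dotvE {R : realType} {n} :=
  (@dotvDl R n, @dotvZl R n, @dotvNl R n, @dotvDr R n, @dotvZr R n, @dotvNr R n).

Lemma dotv_ge0 {R : realType} {n} (u : 'rV[R]_n) : 0 <= dotv u u.
Proof. by apply: sumr_ge0 => i _; rewrite -expr2 sqr_ge0. Qed.

Lemma dotv_eq0 {R : realType} {n} (u : 'rV[R]_n) : dotv u u = 0 -> u = 0.
Proof.
move=> /eqP; rewrite psumr_eq0; last by move=> i _; rewrite -expr2 sqr_ge0.
move=> /allP h; apply/rowP => i; rewrite mxE.
by have := h i (mem_index_enum i); rewrite mulf_eq0 orbb => /eqP.
Qed.

Lemma enorm_ge0 {R : realType} {n} (u : 'rV[R]_n) : 0 <= enorm u.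
Proof. exact: sqrtr_ge0. Qed.

Lemma sqr_enorm {R : realType} {n} (u : 'rV[R]_n) : enorm u ^+ 2 = dotv u u.
Proof. exact/sqr_sqrtr/dotv_ge0. Qed.

(** Cauchy-Schwarz: for nonzero v, the squared norm of <v, v> u - <u, v> v is <v, v> (<u, u> <v, v>
    - <u, v>^2), and the positive factor <v, v> cancels. *)
Lemma dotv_le_enorm {R : realType} {n} (u v : 'rV[R]_n) :
  dotv u v <= enorm u * enorm v.
Proof.
have [->|/eqP v0] := eqVneq v 0.
  rewrite -(scale0r 0) dotvZr mul0r mulr_ge0 ?enorm_ge0 //.
have vp : 0 < dotv v v.
  by rewrite lt_def dotv_ge0 andbT; apply/eqP => /dotv_eq0.
apply: (le_trans (ler_norm _)).
rewrite -(@ler_pXn2r _ 2) ?nnegrE ?mulr_ge0 ?enorm_ge0 //.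
rewrite real_normK ?num_real // exprMn !sqr_enorm.
have := dotv_ge0 (dotv v v *: u - dotv u v *: v).
rewrite !dotvE (dotvC v u) => h.
rewrite -(ler_pM2l vp); nra.
Qed.

Lemma enormN {R : realType} {n} (u : 'rV[R]_n) : enorm (- u) = enorm u.
Proof. by rewrite /enorm !dotvE opprK. Qed.

Lemma enormZ {R : realType} {n} (a : R) (u : 'rV[R]_n) :
  0 <= a -> enorm (a *: u) = a * enorm u.
Proof.
by move=> a0; rewrite /enorm !dotvE mulrA sqrtrM ?mulr_ge0 // -expr2 sqrtr_sqr ger0_norm.
Qed.

Lemma ler_enormD {R : realType} {n} (u v : 'rV[R]_n) :
  enorm (u + v) <= enorm u + enorm v.
Proof.
rewrite -(@ler_pXn2r _ 2) ?nnegrE ?addr_ge0 ?enorm_ge0 //.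
rewrite sqr_enorm sqrrD !sqr_enorm !dotvE (dotvC v u).
have := dotv_le_enorm u v; lra.
Qed.

(** * Gradients and first-order optimality *)

Lemma gradN {R : realType} {n} (g : 'rV[R]_n -> R^o) (z : 'rV[R]_n) :
  differentiable g z -> grad (fun u => - g u) z = - grad g z.
Proof.
move=> dg; apply/rowP => i; rewrite !mxE.
by rewrite -[LHS]/('D_(delta_mx 0 i) (- g) z) deriveN //; apply: diff_derivable.
Qed.

(* Convexity at [zs - t *: d], with [d] the gradient at [zs], gives
   <grad g (zs - t d), d> <= 0, while the Lipschitz bound keeps that gradient within
   [enorm d / 2] of [d]. *)
Lemma grad_minimizer_eq0 {R : realType} {n} (mu L : R) (g : 'rV[R]_n -> R^o)
    (zs : 'rV[R]_n) :
  0 <= mu -> 0 < L -> strongly_convex mu g ->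
  (forall z z', enorm (grad g z' - grad g z) <= L * enorm (z' - z)) ->
  (forall z, g zs <= g z) -> grad g zs = 0.
Proof.
move=> mu0 L0 cvx lip gmin; apply: dotv_eq0.
set d := grad g zs; set t := (2 * L)^-1.
have tp : 0 < t by rewrite invr_gt0 mulr_gt0.
set z := zs - t *: d.
have := cvx z zs; have := gmin z.
have -> : zs - z = t *: d by rewrite /z opprB addrC subrK.
rewrite dotvZr => h1 h2.
have h3 : 0 <= mu / 2 * enorm (t *: d) ^+ 2 by rewrite mulr_ge0 ?sqr_ge0 ?divr_ge0.
have h4 : dotv (grad g z) d <= 0 by rewrite -(ler_pM2l tp) mulr0; lra.
have h5 := dotv_le_enorm (d - grad g z) d.
have h6 := lip z zs.
have e : zs - z = t *: d by rewrite /z opprB addrC subrK.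
rewrite e (enormZ _ (ltW tp)) -/d in h6.
have tL : L * t = 2^-1 by rewrite /t; field; lra.
rewrite mulrA tL in h6.
have h7 := ler_wpM2r (enorm_ge0 d) h6.
rewrite !dotvE in h5.
have h8 := sqr_enorm d; have h9 := dotv_ge0 d.
rewrite -mulrA -expr2 h8 in h7.
lra.
Qed.

(** * The step size conditions and the constant *)

(** Turns the extended-real condition into two bounds free of division by [Lxy]. For [Lxy = 0],
    where the fraction is +oo, the second one has left side 0. *)
Lemma step_boundP {R : realType} (C L mu mu' Lxy a : R) :
  0 < C -> 0 < L -> 0 < mu -> 0 < mu' -> 0 <= Lxy ->
  (a%:E <= step_bound C L mu mu' Lxy)%E ->
  a * L <= C /\ a * Lxy <= C * Num.sqrt (mu' / mu).
Proof.
move=> C0 L0 mu0 mu'0 Lxy0 h.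
have s0 : 0 < Num.sqrt mu by rewrite sqrtr_gt0.
have bd (b : \bar R) : (Order.min (1 / L)%:E
    ((Num.sqrt mu')%:E / (Lxy * Num.sqrt mu)%:E) <= b)%E -> (a%:E <= C%:E * b)%E.
  by move=> hb; apply: (le_trans h); rewrite /step_bound lee_pmul2l ?lte_fin.
split.
  have : (a%:E <= C%:E * (1 / L)%:E)%E by apply: bd; rewrite ge_min lexx.
  by rewrite -EFinM lee_fin mul1r ler_pdivlMr.
rewrite sqrtrM ?(ltW mu'0) // sqrtrV ?(ltW mu0) //.
have [->|Lxy1] := eqVneq Lxy 0.
  by rewrite mulr0 mulr_ge0 ?divr_ge0 ?sqrtr_ge0 ?ltW.
have {Lxy1}Lxy0 : 0 < Lxy by rewrite lt_def Lxy1.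
have : (a%:E <= C%:E * ((Num.sqrt mu')%:E / (Lxy * Num.sqrt mu)%:E))%E.
  by apply: bd; rewrite ge_min lexx orbT.
rewrite inver mulf_eq0 !gt_eqF //= -!EFinM lee_fin invfM.
rewrite -(ler_pM2r Lxy0) => /le_trans; apply.
rewrite [leLHS](_ : _ = C * (Num.sqrt mu' / Num.sqrt mu)) //.
by field; rewrite !gt_eqF.
Qed.

(** The constant C of the theorem. Its form keeps C gamma^2 delta, C gamma delta^2 and C gamma delta
    at most (gamma - 1) / 20, (delta - 1) / 20 and 1 / 20, the smallness by which the errors are
    absorbed. *)
Definition step_const {R : realType} (gamma delta : R) : R :=
  (gamma - 1) * (delta - 1) / (20 * gamma ^+ 2 * delta ^+ 2).

Lemma step_const_gt0 {R : realType} (gamma delta : R) :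
  1 < gamma -> 1 < delta -> 0 < step_const gamma delta.
Proof.
by move=> g1 d1; rewrite divr_gt0 ?mulr_gt0 ?exprn_gt0 ?subr_gt0 //; lra.
Qed.

Lemma step_const_gamma {R : realType} (gamma delta : R) :
  1 < gamma -> 1 < delta ->
  20 * (step_const gamma delta * (gamma ^+ 2 * delta)) <= gamma - 1.
Proof.
move=> g1 d1; rewrite /step_const.
rewrite [leLHS](_ : _ = (gamma - 1) * ((delta - 1) / delta)); last by field; lra.
rewrite ler_piMr ?ler_pdivrMr; lra.
Qed.

Lemma step_const_delta {R : realType} (gamma delta : R) :
  1 < gamma -> 1 < delta ->
  20 * (step_const gamma delta * (gamma * delta ^+ 2)) <= delta - 1.
Proof.
move=> g1 d1; rewrite /step_const.
rewrite [leLHS](_ : _ = (delta - 1) * ((gamma - 1) / gamma)); last by field; lra.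
rewrite ler_piMr ?ler_pdivrMr; lra.
Qed.

Lemma step_const_prod {R : realType} (gamma delta : R) :
  1 < gamma -> 1 < delta -> 20 * (step_const gamma delta * (gamma * delta)) <= 1.
Proof.
move=> g1 d1; rewrite /step_const.
rewrite [leLHS](_ : _ = ((gamma - 1) / gamma) * ((delta - 1) / delta)); last by field; lra.
apply: mulr_ile1; rewrite ?divr_ge0 ?ler_pdivrMr; lra.
Qed.

(** * Young inequalities and absorption of the error terms *)

(** Start from 2 m p q <= m^2 p^2 + q^2 times a b L. The bound on [b * L * m] handles the p^2 term,
    the one on [a * L] the q^2 term, and the weight m cancels. *)
Lemma coupling_young {R : realType} (C m a b L p q : R) :
  0 < m -> 0 <= a -> 0 <= b -> 0 <= L -> a * L <= C * m -> b * L * m <= C ->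
  2 * (a * b * L * (p * q)) <= C * (a * p ^+ 2 + b * q ^+ 2).
Proof.
move=> m0 a0 b0 L0 aL bL; rewrite -(ler_pM2l m0).
have abL : 0 <= a * b * L by rewrite !mulr_ge0.
have h1 := mulr_ge0 abL (sqr_ge0 (m * p - q)).
have h2 := ler_wpM2l (mulr_ge0 b0 (sqr_ge0 q)) aL.
have h3 := ler_wpM2l (mulr_ge0 (mulr_ge0 a0 (sqr_ge0 p)) (ltW m0)) bL.
nra.
Qed.

(** Young with the weight on q. The q^2 term is left with its full coefficient, to be matched by the
    memory term of the Lyapunov function. *)
Lemma coupling_young_weighted {R : realType} (C m a b L p q : R) :
  0 < m -> 0 <= a -> 0 <= b -> 0 <= L -> a * L <= C * m ->
  2 * (a * b * L * (p * q)) <= C * (b * p ^+ 2) + a * b * L * m * q ^+ 2.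
Proof.
move=> m0 a0 b0 L0 aL; rewrite -(ler_pM2l m0).
have abL : 0 <= a * b * L by rewrite !mulr_ge0.
have h1 := mulr_ge0 abL (sqr_ge0 (m * q - p)).
have h2 := ler_wpM2l (mulr_ge0 b0 (sqr_ge0 p)) aL.
nra.
Qed.

(** Totals the coefficients with which the errors charge [a * G ^+ 2] in [step_error_le0]; the
    polynomial is at most 20 gamma^2 delta. The next two lemmas do the same for [b * H ^+ 2] and
    [b * P ^+ 2]. *)
Lemma primal_error_coefficient {R : realType} (gamma delta : R) :
  1 < gamma -> 1 < delta ->
  (2 * (2 * gamma - 1) * gamma + (2 * gamma - 1) * (delta - 1) + delta * (gamma - 1)
    + 2 * ((gamma - 1) * (delta - 1)) + 6 * gamma ^+ 2 + 4)
  * step_const gamma delta <= 4 * (gamma - 1).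
Proof.
move=> g1 d1.
have k1 : 1 <= gamma * delta by rewrite mulr_ege1 ?ltW.
have k2 : gamma * delta <= gamma ^+ 2 * delta by nra.
have k3 : gamma ^+ 2 <= gamma ^+ 2 * delta by nra.
have : 2 * (2 * gamma - 1) * gamma + (2 * gamma - 1) * (delta - 1) + delta * (gamma - 1)
    + 2 * ((gamma - 1) * (delta - 1)) + 6 * gamma ^+ 2 + 4 <= 20 * (gamma ^+ 2 * delta).
  by nra.
move=> /(ler_wpM2r (ltW (step_const_gt0 g1 d1))).
have := step_const_gamma g1 d1; lra.
Qed.

Lemma dual_error_coefficient {R : realType} (gamma delta : R) :
  1 < gamma -> 1 < delta ->
  (2 * delta ^+ 2 + delta * (gamma - 1)) * step_const gamma delta <= delta - 1.
Proof.
move=> g1 d1.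
have k1 : delta ^+ 2 <= gamma * delta ^+ 2 by nra.
have k2 : gamma * delta <= gamma * delta ^+ 2 by nra.
have : 2 * delta ^+ 2 + delta * (gamma - 1) <= 20 * (gamma * delta ^+ 2) by nra.
move=> /(ler_wpM2r (ltW (step_const_gt0 g1 d1))).
have := step_const_delta g1 d1; lra.
Qed.

Lemma past_dual_error_coefficient {R : realType} (gamma delta : R) :
  1 < gamma -> 1 < delta ->
  ((2 * gamma - 1) * (delta - 1) + 2 * (delta - 1) * delta
    + (gamma - 1) * (delta - 1) + (delta - 1)) * step_const gamma delta
  <= 3 * (delta - 1).
Proof.
move=> g1 d1; have t0 : 0 <= delta - 1 by lra.
have k1 : delta <= gamma * delta by nra.
have : (2 * gamma - 1) + 2 * delta + (gamma - 1) + 1 <= 20 * (gamma * delta) by nra.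
move=> /(ler_wpM2r (ltW (step_const_gt0 g1 d1))) k2.
have {k2} k : (2 * gamma - 1 + 2 * delta + (gamma - 1) + 1) * step_const gamma delta <= 1.
  by have := step_const_prod g1 d1; lra.
by have := ler_wpM2l t0 k; lra.
Qed.

(* The left-hand side bounds Psi_{k+1} - r Psi_k, where G, H, P, q are the norms of
   grad_x f(x_k, yt_k), grad_y f(xt_{k+1}, y_k), grad_y f(xt_k, y_{k-1}) and
   grad_x f(x_{k-1}, yt_{k-1}). The [P * q] coupling is the only term absorbed by
   [K' * q ^+ 2], which is why the Lyapunov function carries that summand. *)
Lemma step_error_le0 {R : realType}
    (gamma delta m a b mux muy Lx Ly Lxy G H P q : R) :
  let C := step_const gamma delta in
  let K' := (gamma - 1) * (delta - 1) * (a * b * Lxy * m) in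
  1 < gamma -> 1 < delta -> 0 < m -> 0 < a -> 0 < b -> 0 <= Lxy ->
  a * Lx <= C -> a * mux <= C -> b * Ly <= C -> b * muy <= C ->
  a * Lxy <= C * m -> b * Lxy * m <= C ->
  - 4 * (gamma - 1) * (a * G ^+ 2) - (delta - 1) * (b * H ^+ 2)
    - 3 * (delta - 1) * (b * P ^+ 2)
    + 2 * (2 * gamma - 1)
        * (a * G * (Lx * (gamma * a * G) + Lxy * ((delta - 1) * b * P)))
    + 2 * delta * (b * H * (Ly * (delta * b * H) + Lxy * ((gamma - 1) * a * G)))
    + 2 * (delta - 1) * (b * P * (Ly * (delta * b * P) + Lxy * ((gamma - 1) * a * q)))
    + K' / (1 - a * mux) * G ^+ 2 - K' * q ^+ 2
    + (6 * gamma ^+ 2 + 4) * (a * mux * (a * G ^+ 2))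
    + (delta - 1) * (b * muy * (b * P ^+ 2)) <= 0.
Proof.
move=> C K' g1 d1 m0 a0 b0 L0 aLx amux bLy bmuy aLxy bLxy.
have C0 : 0 < C := step_const_gt0 g1 d1.
have C1 : 20 * (C * (gamma * delta)) <= 1 := step_const_prod g1 d1.
set u := a * G ^+ 2; set v := b * H ^+ 2; set w := b * P ^+ 2.
have u0 : 0 <= u by rewrite mulr_ge0 ?sqr_ge0 ?ltW.
have v0 : 0 <= v by rewrite mulr_ge0 ?sqr_ge0 ?ltW.
have w0 : 0 <= w by rewrite mulr_ge0 ?sqr_ge0 ?ltW.
have e1 := ler_wpM2r u0 aLx.
have e2 := coupling_young G P m0 (ltW a0) (ltW b0) L0 aLxy bLxy.
have e3 := ler_wpM2r v0 bLy.
have e4 := coupling_young G H m0 (ltW a0) (ltW b0) L0 aLxy bLxy.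
have e5 := ler_wpM2r w0 bLy.
have e6 := coupling_young_weighted P q m0 (ltW a0) (ltW b0) L0 aLxy.
have e7 := ler_wpM2r u0 amux.
have e8 := ler_wpM2r w0 bmuy.
set s := gamma - 1; set t := delta - 1.
have s0 : 0 < s by rewrite /s; lra.
have t0 : 0 < t by rewrite /t; lra.
have g0 : 0 <= gamma by lra.
have d0 : 0 <= delta by lra.
have gg : 0 <= 2 * gamma - 1 by lra.
have g6 : 0 <= 6 * gamma ^+ 2 + 4 by rewrite addr_ge0 ?mulr_ge0 ?sqr_ge0.
have ler02 : (0 : R) <= 2 by [].
(* Since [a * mux <= C], this gives 1 / (1 - a mux) <= 2, which removes the denominator in [K1]. *)
have Chalf : C <= 1 / 2.
  have : 1 <= gamma * delta by rewrite mulr_ege1 ?ltW.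
  by move=> /(ler_wpM2l (ltW C0)); lra.
have K1 : K' / (1 - a * mux) * G ^+ 2 <= 2 * (s * t) * (C * u).
  have hK : K' <= s * t * a * C.
    have := ler_wpM2l (mulr_ge0 (mulr_ge0 (ltW s0) (ltW t0)) (ltW a0)) bLxy.
    by rewrite /K' -/s -/t; lra.
  rewrite [leRHS](_ : _ = 2 * (s * t * a * C) * G ^+ 2); last by rewrite /u; ring.
  rewrite ler_wpM2r ?sqr_ge0 // ler_pdivrMr; last lra.
  have st : 0 <= s * t * a * C.
    exact: mulr_ge0 (mulr_ge0 (mulr_ge0 (ltW s0) (ltW t0)) (ltW a0)) (ltW C0).
  by nra.
rewrite -/s -/t in e1 e2 e3 e4 e5 e6 e7 e8 K1 *.
rewrite -/u -/v -/w in e1 e2 e3 e4 e5 e6 e7 e8 K1.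
(* The multipliers are, up to factors 2, the coefficients of the error terms in the goal; the
   resulting multiples of [u], [v], [w] add up to the left sides of [c1], [c2], [c3]. *)
have f1 := ler_wpM2l (mulr_ge0 (mulr_ge0 ler02 gg) g0) e1.
have f2 := ler_wpM2l (mulr_ge0 gg (ltW t0)) e2.
have f3 := ler_wpM2l (sqr_ge0 delta) e3.
have f4 := ler_wpM2l (mulr_ge0 d0 (ltW s0)) e4.
have f5 := ler_wpM2l (mulr_ge0 (ltW t0) d0) e5.
have f6 := ler_wpM2l (mulr_ge0 (ltW s0) (ltW t0)) e6.
have f7 := ler_wpM2l g6 e7.
have f8 := ler_wpM2l (ltW t0) e8.
have c1 := primal_error_coefficient g1 d1; have c2 := dual_error_coefficient g1 d1.
have c3 := past_dual_error_coefficient g1 d1.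
rewrite -/C -/s -/t in c1 c2 c3.
have {}c1 := ler_wpM2r u0 c1.
have {}c2 := ler_wpM2r v0 c2.
have {}c3 := ler_wpM2r w0 c3.
clear - f1 f2 f3 f4 f5 f6 f7 f8 c1 c2 c3 K1.
rewrite /K' -/s -/t /u /v /w in f1 f2 f3 f4 f5 f6 f7 f8 c1 c2 c3 K1 *.
lra.
Qed.

(** * Vector estimates for a single step *)

Lemma dotv_perturb {R : realType} {n} (u v : 'rV[R]_n) (e : R) :
  enorm (u - v) <= e -> dotv v v - enorm v * e <= dotv u v.
Proof.
move=> h; have := dotv_le_enorm (v - u) v.
rewrite -opprB enormN !dotvE.
have := ler_wpM2l (enorm_ge0 v) h; lra.
Qed.

(** Moves one argument at a time, through [A x y']. Being abstract in [A], it serves [gradx] and,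
    with swapped arguments, [grady]. *)
Lemma enorm_sub_smooth {R : realType} {m n p} (A : 'rV[R]_m -> 'rV[R]_n -> 'rV[R]_p)
    (L M d e : R) (x x' : 'rV[R]_m) (y y' : 'rV[R]_n) :
  0 <= L -> 0 <= M ->
  (forall u u' v, enorm (A u' v - A u v) <= L * enorm (u' - u)) ->
  (forall u v v', enorm (A u v' - A u v) <= M * enorm (v' - v)) ->
  enorm (x' - x) <= d -> enorm (y' - y) <= e ->
  enorm (A x' y' - A x y) <= L * d + M * e.
Proof.
move=> L0 M0 hL hM hd he.
have -> : A x' y' - A x y = (A x' y' - A x y') + (A x y' - A x y).
  by rewrite addrA subrK.
apply: (le_trans (ler_enormD _ _)); apply: lerD.
  by apply: (le_trans (hL _ _ _)); rewrite ler_wpM2l.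
by apply: (le_trans (hM _ _ _)); rewrite ler_wpM2l.
Qed.

(** The x-part of [alex_core] at the next iterate: X is the centred current iterate and g' the next
    gradient. *)
Lemma primal_potential_step {R : realType} {n} (a : R) (X g g' : 'rV[R]_n) :
  a != 0 ->
  2 / a * dotv (X - a *: g) (X - a *: g) - 2 * dotv g' (X - a *: g)
  = 2 / a * dotv X X - 4 * dotv g X + 2 * a * dotv g g
    - 2 * (dotv g' X - a * dotv g' g).
Proof.
by move=> a0; rewrite !dotvE (dotvC X g); field.
Qed.

Lemma dual_potential_step {R : realType} {n} (b : R) (Y h : 'rV[R]_n) :
  b != 0 ->
  2 / b * dotv (Y + b *: h) (Y + b *: h)
  = 2 / b * dotv Y Y + 4 * dotv h Y + 2 * b * dotv h h.
Proof.
by move=> b0; rewrite !dotvE (dotvC Y h); field.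
Qed.

Lemma sqr_distance_step_ge {R : realType} {n} (c : R) (X g : 'rV[R]_n) :
  3 / 4 * dotv X X - 3 * c ^+ 2 * dotv g g <= dotv (X - c *: g) (X - c *: g).
Proof.
have := dotv_ge0 (2^-1 *: X - (2 * c) *: g).
by rewrite !dotvE (dotvC X g); lra.
Qed.

(** Controls the cross term of rho Psi_k. The Young bound has a nonnegative right side, so rho may
    be raised to a mu in front of it. *)
Lemma neg_dotv_young {R : realType} {n} (a mu rho : R) (X g : 'rV[R]_n) :
  0 < a -> 0 <= rho -> rho <= a * mu ->
  rho * (- 2 * dotv g X) <= mu / 4 * dotv X X + 4 * (mu * a ^+ 2) * dotv g g.
Proof.
move=> a0 rho0 rhoa.
have h0 := dotv_ge0 (2^-1 *: X + (2 * a) *: g).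
rewrite !dotvE (dotvC X g) in h0.
have h1 : a * (- 2 * dotv g X) <= 1 / 4 * dotv X X + 4 * a ^+ 2 * dotv g g by lra.
have h2 := ler_wpM2l rho0 h1.
have h3 : 0 <= 1 / 4 * dotv X X + 4 * a ^+ 2 * dotv g g.
  by have := dotv_ge0 X; have := mulr_ge0 (sqr_ge0 a) (dotv_ge0 g); lra.
have h4 := ler_wpM2r h3 rhoa.
by rewrite -(ler_pM2l a0); lra.
Qed.

Lemma contraction_weight_le {R : realType} (a mu rho p : R) :
  0 < a -> rho <= a * mu -> 0 <= p -> rho * (2 / a * p) <= 2 * mu * p.
Proof.
move=> a0 rhoa p0; rewrite mulrA ler_wpM2r //.
rewrite [leLHS](_ : _ = 2 * rho / a); last by field; rewrite gt_eqF.
by rewrite ler_pdivrMr //; lra.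
Qed.

(** * The Lyapunov function over one step of the algorithm *)

Section Saddle.
Context {R : realType} {dx dy : nat}.
Variables (mux muy Lx Ly Lxy : R) (f : 'rV[R]_dx * 'rV[R]_dy -> R^o).
Hypothesis F : function_class mux muy Lx Ly Lxy f.

Lemma function_class_convex x x' y :
  f (x, y) + dotv (gradx f x y) (x' - x) + mux / 2 * dotv (x' - x) (x' - x)
    <= f (x', y).
Proof. by rewrite -sqr_enorm; exact: (fc_strongly_convex F). Qed.

Lemma gradN_slice x y :
  grad (fun v => - f (x, v)) y = - grady f x y.
Proof.
rewrite gradN //.
apply: (@differentiable_comp _ _ _ _ (fun v => (x, v)) f).
  by apply: differentiable_pair.
exact: (fc_twice_differentiable F).1.
Qed.

Lemma function_class_concave x y y' :
  f (x, y') <= f (x, y) + dotv (grady f x y) (y' - y)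
    - muy / 2 * dotv (y' - y) (y' - y).
Proof.
have := fc_strongly_concave F x y y'.
by rewrite gradN_slice sqr_enorm !dotvE; lra.
Qed.

Hypotheses (mux0 : 0 < mux) (muxL : mux <= Lx) (muy0 : 0 < muy) (muyL : muy <= Ly).
Hypothesis Lxy0 : 0 <= Lxy.
Variable zs : 'rV[R]_dx * 'rV[R]_dy.
Hypothesis N : nash_equilibrium f zs.

Lemma gradx_nash : gradx f zs.1 zs.2 = 0.
Proof.
apply: (@grad_minimizer_eq0 _ _ mux Lx (fun u => f (u, zs.2))).
- exact: ltW.
- exact: lt_le_trans muxL.
- exact: (fc_strongly_convex F).
- by move=> z z'; exact: (fc_smooth_xx F).
- by move=> z; have [_] := N z zs.2; rewrite -surjective_pairing.
Qed.

(* The part V(x_k, y_k) + V(x_{k+1}, y_k) - a |g|^2 of the Lyapunov function after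
   substituting x_{k+1} = x - a g; see [psi_base_alex_core]. *)
Definition alex_core (a b : R) (x : 'rV[R]_dx) (y : 'rV[R]_dy) (g : 'rV[R]_dx) : R :=
  2 / a * dotv (x - zs.1) (x - zs.1) - 2 * dotv g (x - zs.1)
  + 2 / b * dotv (y - zs.2) (y - zs.2).

(** [E1] to [E6] bound the left side by 2 (f(xt1, y) - f(x1, yt1)) + 2 (f(xt1, y) - f(x, yt)) minus
    quadratic terms. The differences are split at f(x1, y) ([E7], [E8]) and at f(x, y) ([E9],
    [E10]). *)
Lemma alex_gap (a b ga de : R) (x g : 'rV[R]_dx) (y yt hp h : 'rV[R]_dy) :
  let x1 := x - a *: g in
  let xt1 := x - (ga * a) *: g in
  let yt1 := y + (de * b) *: h in
  let g' := gradx f x1 yt1 in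
  g = gradx f x yt -> h = grady f xt1 y -> yt = y + ((de - 1) * b) *: hp ->
  - 2 * (dotv g' (x - zs.1) - a * dotv g' g) - 2 * dotv g (x - zs.1)
    + 4 * dotv h (y - zs.2)
  <= - (5 / 2) * mux * dotv (x - zs.1) (x - zs.1)
     - 2 * muy * dotv (y - zs.2) (y - zs.2)
     + 6 * mux * (ga * a) ^+ 2 * dotv g g
     - 2 * ((ga - 1) * a + ga * a) * dotv (gradx f xt1 y) g
     - 2 * (de * b) * dotv (grady f x1 yt1) h
     - 2 * ((de - 1) * b) * dotv (grady f x yt) hp.
Proof.
move=> x1 xt1 yt1 g' gE hE ytE.
have E1 : f (x1, yt1) - (dotv g' (x - zs.1) - a * dotv g' g) <= f (zs.1, yt1).
  have := function_class_convex x1 zs.1 yt1.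
  have -> : zs.1 - x1 = - ((x - zs.1) - a *: g).
    by apply/rowP => i; rewrite !mxE; ring.
  rewrite (dotvNr _ (gradx _ _ _)) dotvDr (dotvNr (a *: g)) (dotvZr a g).
  have := mulr_ge0 (ltW mux0) (dotv_ge0 (- ((x - zs.1) - a *: g))).
  by rewrite -/g'; lra.
have E2 : f (x, yt) - dotv g (x - zs.1) + mux / 2 * dotv (x - zs.1) (x - zs.1)
    <= f (zs.1, yt).
  have := function_class_convex x zs.1 yt.
  by rewrite -(opprB x zs.1) !dotvNr dotvNl opprK gE.
have E3 : f (xt1, zs.2) <= f (xt1, y) - dotv h (y - zs.2)
    - muy / 2 * dotv (y - zs.2) (y - zs.2).
  have := function_class_concave xt1 y zs.2.
  by rewrite -(opprB y zs.2) !dotvNr dotvNl opprK hE.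
have [E4 _] := N x yt1; have [E5 _] := N x yt.
have E6 : f zs + mux / 2 * dotv (xt1 - zs.1) (xt1 - zs.1) <= f (xt1, zs.2).
  have := function_class_convex zs.1 xt1 zs.2.
  by rewrite gradx_nash -(scale0r 0) dotvZl mul0r addr0 -surjective_pairing.
have E7 : f (xt1, y) + (ga - 1) * a * dotv (gradx f xt1 y) g <= f (x1, y).
  have := function_class_convex xt1 x1 y.
  have -> : x1 - xt1 = ((ga - 1) * a) *: g.
    by rewrite /x1 /xt1; apply/rowP => i; rewrite !mxE; ring.
  rewrite (dotvZr _ g (gradx _ _ _)).
  by have := mulr_ge0 (ltW mux0) (dotv_ge0 (((ga - 1) * a) *: g)); lra.
have E8 : f (x1, y) <= f (x1, yt1) - de * b * dotv (grady f x1 yt1) h.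
  have := function_class_concave x1 yt1 y.
  have -> : y - yt1 = - ((de * b) *: h).
    by rewrite /yt1; apply/rowP => i; rewrite !mxE; ring.
  rewrite (dotvNr _ (grady _ _ _)) (dotvZr _ h (grady _ _ _)).
  by have := mulr_ge0 (ltW muy0) (dotv_ge0 (- ((de * b) *: h))); lra.
have E9 : f (xt1, y) + ga * a * dotv (gradx f xt1 y) g <= f (x, y).
  have := function_class_convex xt1 x y.
  have -> : x - xt1 = (ga * a) *: g.
    by rewrite /xt1; apply/rowP => i; rewrite !mxE; ring.
  rewrite (dotvZr _ g (gradx _ _ _)).
  by have := mulr_ge0 (ltW mux0) (dotv_ge0 ((ga * a) *: g)); lra.
have E10 : f (x, y) <= f (x, yt) - (de - 1) * b * dotv (grady f x yt) hp.
  have := function_class_concave x yt y.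
  have -> : y - yt = - (((de - 1) * b) *: hp).
    by rewrite ytE; apply/rowP => i; rewrite !mxE; ring.
  rewrite (dotvNr _ (grady _ _ _)) (dotvZr _ hp (grady _ _ _)).
  by have := mulr_ge0 (ltW muy0) (dotv_ge0 (- (((de - 1) * b) *: hp))); lra.
(* [E6] measures the distance from [xt1]; this returns to [x]. It contributes 3/2 mux and [E2]
   contributes mux, hence the 5/2. *)
have E11 := ler_wpM2l (ltW mux0) (sqr_distance_step_ge (ga * a) (x - zs.1) g).
rewrite (addrAC x) -/xt1 in E11.
lra.
Qed.

(* [hp] and [q] stand for the gradient grad_y f(xt_k, y_{k-1}) and for the norm of
   grad_x f(x_{k-1}, yt_{k-1}); the first step is the instance [hp = 0], [q = 0]. *)
Lemma alex_step (gamma delta m a b q rho : R)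
    (x : 'rV[R]_dx) (y yt hp : 'rV[R]_dy) :
  let C := step_const gamma delta in
  let K := (gamma - 1) * (delta - 1) * (a * b * Lxy * m) / (1 - a * mux) in
  let g := gradx f x yt in
  let x1 := x - a *: g in
  let xt1 := x - (gamma * a) *: g in
  let h := grady f xt1 y in
  let y1 := y + b *: h in
  let yt1 := y + (delta * b) *: h in
  1 < gamma -> 1 < delta -> 0 < m -> 0 < a -> 0 < b ->
  a * Lx <= C -> b * Ly <= C -> a * Lxy <= C * m -> b * Lxy * m <= C ->
  a * mux < 1 -> 0 <= rho -> rho <= a * mux -> rho <= b * muy ->
  yt = y + ((delta - 1) * b) *: hp ->
  dotv hp hp - enorm hp * (Ly * (delta * b * enorm hp) + Lxy * ((gamma - 1) * a * q))
    <= dotv (grady f x yt) hp ->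
  alex_core a b x1 y1 (gradx f x1 yt1) + (delta - 1) * b * dotv h h + K * dotv g g
  <= (1 - rho) *
     (alex_core a b x y g + (delta - 1) * b * dotv hp hp + K * q ^+ 2).
Proof.
move=> C K g x1 xt1 h y1 yt1 g1 d1 m0 a0 b0 aLx bLy aLxy bLxy amux rho0 rhoa rhob
  ytE hpE.
have Lx0 : 0 <= Lx by apply: le_trans muxL; exact: ltW.
have Ly0 : 0 <= Ly by apply: le_trans muyL; exact: ltW.
have amux' : a * mux <= C by apply: le_trans aLx; rewrite ler_wpM2l ?(ltW a0).
have bmuy' : b * muy <= C by apply: le_trans bLy; rewrite ler_wpM2l ?(ltW b0).
have main := step_error_le0 (enorm g) (enorm h) (enorm hp) q g1 d1 m0 a0 b0 Lxy0
  aLx amux' bLy bmuy' aLxy bLxy.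
rewrite -/K !sqr_enorm in main.
have ga0 : 0 <= gamma * a by apply: mulr_ge0; lra.
have sa0 : 0 <= (gamma - 1) * a by apply: mulr_ge0; lra.
have db0 : 0 <= delta * b by apply: mulr_ge0; lra.
have tb0 : 0 <= (delta - 1) * b by apply: mulr_ge0; lra.
(* [xt1 - x] and [y - yt] are multiples of [g] and [hp], so the gradient at (xt1, y) stays close to
   [g]; [P2] compares with [h] in the same way. *)
have P1 : dotv g g - enorm g * (Lx * (gamma * a * enorm g)
    + Lxy * ((delta - 1) * b * enorm hp)) <= dotv (gradx f xt1 y) g.
  apply/dotv_perturb/(enorm_sub_smooth Lx0 Lxy0 (fc_smooth_xx F) (fc_smooth_xy F)).
    by rewrite /xt1 (addrC x) addrK enormN enormZ.
  by rewrite ytE opprD addrA subrr sub0r enormN enormZ.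
have P2 : dotv h h - enorm h * (Ly * (delta * b * enorm h)
    + Lxy * ((gamma - 1) * a * enorm g)) <= dotv (grady f x1 yt1) h.
  apply/dotv_perturb.
  have := @enorm_sub_smooth _ _ _ _ (fun v u => grady f u v) _ _
    (delta * b * enorm h) ((gamma - 1) * a * enorm g) y yt1 xt1 x1
    Ly0 Lxy0 (fun v v' u => fc_smooth_yy F u v v') (fun v u u' => fc_smooth_yx F u u' v).
  apply; first by rewrite /yt1 (addrC y) addrK enormZ.
  rewrite (_ : x1 - xt1 = ((gamma - 1) * a) *: g) ?enormZ //.
  by rewrite /x1 /xt1; apply/rowP => i; rewrite !mxE; ring.
have gap := @alex_gap a b gamma delta x g y yt hp h erefl erefl ytE.
have {}P1 := ler_wpM2l (addr_ge0 sa0 ga0) P1.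
have {}P2 := ler_wpM2l db0 P2.
have {}hpE := ler_wpM2l tb0 hpE.
(* [G1] to [G4] bound the parts of rho Psi_k. Of the 5/2 mux in [gap], [G1] takes 2 and [G3] takes
   1/4; [G2] takes all of 2 muy. *)
have G1 := contraction_weight_le a0 rhoa (dotv_ge0 (x - zs.1)).
have G2 := contraction_weight_le b0 rhob (dotv_ge0 (y - zs.2)).
have G3 := neg_dotv_young (x - zs.1) g a0 rho0 rhoa.
have G4 : rho * ((delta - 1) * b * dotv hp hp) <= (delta - 1) * (b * muy * (b * dotv hp hp)).
  rewrite [leRHS](_ : _ = b * muy * ((delta - 1) * b * dotv hp hp)); last by ring.
  by apply: ler_wpM2r => //; exact: mulr_ge0 tb0 (dotv_ge0 hp).
(* The divisor 1 - a mux in [K] compensates the factor 1 - rho >= 1 - a mux. *)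
have G5 : (gamma - 1) * (delta - 1) * (a * b * Lxy * m) * q ^+ 2
    <= (1 - rho) * (K * q ^+ 2).
  have K0 : 0 <= K.
    rewrite /K divr_ge0 ?subr_ge0 ?(ltW amux) //.
    by rewrite 2?mulr_ge0 ?subr_ge0 ?(ltW g1) ?(ltW d1) ?mulr_ge0 ?(ltW a0) ?(ltW b0) ?(ltW m0).
  rewrite (mulrA (1 - rho)); apply: (ler_wpM2r (sqr_ge0 q)).
  have -> : (gamma - 1) * (delta - 1) * (a * b * Lxy * m) = (1 - a * mux) * K.
    by rewrite /K (mulrC (1 - a * mux)) divfK // gt_eqF // subr_gt0.
  by apply: ler_wpM2r => //; rewrite lerD2l lerN2.
have C1 : alex_core a b x1 y1 (gradx f x1 yt1) = 2 / a * dotv (x - zs.1) (x - zs.1)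
    - 4 * dotv g (x - zs.1) + 2 * a * dotv g g
    - 2 * (dotv (gradx f x1 yt1) (x - zs.1) - a * dotv (gradx f x1 yt1) g)
    + (2 / b * dotv (y - zs.2) (y - zs.2) + 4 * dotv h (y - zs.2) + 2 * b * dotv h h).
  rewrite -dual_potential_step ?gt_eqF // -primal_potential_step ?gt_eqF //.
  by rewrite /alex_core /x1 /y1 !(addrAC x _ (- zs.1)) (addrAC y _ (- zs.2)).
rewrite C1 /alex_core -/x1 -/xt1 -/yt1.
rewrite -/x1 -/xt1 -/yt1 -/h in gap.
have G6 := mulr_ge0 (ltW mux0) (dotv_ge0 (x - zs.1)).
move: main P1 P2 hpE G6 G1 G2 G3 G4 G5 gap.
move: (_ + Lxy * (_ * enorm hp)) (_ + Lxy * (_ * enorm g)) (_ + Lxy * (_ * q)).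
move: (2 / a * _) (2 / b * _) (_ * (a * b * Lxy * m)).
move: (dotv (gradx f xt1 y) g) (dotv (grady f x1 yt1) h) (dotv (grady f x yt) hp).
move: (dotv (gradx f x1 yt1) (x - zs.1)) (dotv (gradx f x1 yt1) g).
move: (dotv (x - zs.1) (x - zs.1)) (dotv (y - zs.2) (y - zs.2)) (dotv h (y - zs.2)).
move: (dotv g (x - zs.1)) (dotv g g) (dotv h h) (dotv hp hp) (enorm g) (enorm h) (enorm hp).
move: K => K.
move=> *; lra.
Qed.

(** The x-gradient vanishes at the equilibrium, so Lipschitz bounds control the cross term 2 <g, x -
    x*>; as C is small, half of the squared distances and the [hp] term absorb it. *)
Lemma alex_core_ge (gamma delta m a b : R)
    (x : 'rV[R]_dx) (y yt hp : 'rV[R]_dy) :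
  let C := step_const gamma delta in
  1 < gamma -> 1 < delta -> 0 < m -> 0 < a -> 0 < b ->
  a * Lx <= C -> a * Lxy <= C * m -> b * Lxy * m <= C ->
  yt = y + ((delta - 1) * b) *: hp ->
  1 / a * dotv (x - zs.1) (x - zs.1) + 1 / b * dotv (y - zs.2) (y - zs.2)
  <= alex_core a b x y (gradx f x yt) + (delta - 1) * b * dotv hp hp.
Proof.
move=> C g1 d1 m0 a0 b0 aLx aLxy bLxy ytE.
have Lx0 : 0 <= Lx by apply: le_trans muxL; exact: ltW.
have tb0 : 0 <= (delta - 1) * b by apply: mulr_ge0; lra.
have t0 : 0 <= delta - 1 by lra.
have C0 : 0 < C := step_const_gt0 g1 d1.
have [C1 C2] : C <= 1 / 20 /\ C * (delta - 1) <= 1 / 20.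
  have h : 20 * (C * (gamma * delta)) <= 1 := step_const_prod g1 d1.
  have h1 : 1 <= gamma * delta by rewrite mulr_ege1 ?ltW.
  have h2 : delta - 1 <= gamma * delta.
    have : 0 <= (gamma - 1) * delta by apply: mulr_ge0; lra.
    lra.
  have := ler_wpM2l (ltW C0) h1; have := ler_wpM2l (ltW C0) h2.
  by split; lra.
set X := enorm (x - zs.1); set Y := enorm (y - zs.2); set P := enorm hp.
have gX : dotv (gradx f x yt) (x - zs.1) <= (Lx * X + Lxy * (Y + (delta - 1) * b * P)) * X.
  apply: (le_trans (dotv_le_enorm _ _)); rewrite ler_wpM2r ?enorm_ge0 //.
  rewrite -[gradx f x yt]subr0 -gradx_nash.
  apply: (enorm_sub_smooth Lx0 Lxy0 (fc_smooth_xx F) (fc_smooth_xy F)) => //.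
  by rewrite ytE addrAC; apply: (le_trans (ler_enormD _ _)); rewrite enormZ.
rewrite /alex_core -!sqr_enorm -/X -/Y -/P.
have e1 : Lx * X ^+ 2 <= C * (1 / a * X ^+ 2).
  rewrite [leRHS]mulrA; apply: (ler_wpM2r (sqr_ge0 X)).
  by rewrite mul1r ler_pdivlMr // mulrC.
(* The arguments are scaled so that a (X / a)^2 = X^2 / a and a b (X / a) (Y / b) = X Y. *)
have e2 := coupling_young (X / a) (Y / b) m0 (ltW a0) (ltW b0) Lxy0 aLxy bLxy.
have e3 := coupling_young (X / a) P m0 (ltW a0) (ltW b0) Lxy0 aLxy bLxy.
have a1 : a != 0 by rewrite gt_eqF.
have b1 : b != 0 by rewrite gt_eqF.
rewrite (_ : 2 * _ = 2 * (Lxy * X * Y)) in e2; last by field; rewrite a1 b1.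
rewrite (_ : 2 * _ = 2 * (b * Lxy * X * P)) in e3; last by field.
rewrite (_ : a * _ ^+ 2 = 1 / a * X ^+ 2) in e2; last by field.
rewrite (_ : b * _ ^+ 2 = 1 / b * Y ^+ 2) in e2; last by field.
rewrite (_ : a * _ ^+ 2 = 1 / a * X ^+ 2) in e3; last by field.
have {}e3 := ler_wpM2l t0 e3.
have u0 : 0 <= 1 / a * X ^+ 2 by rewrite mulr_ge0 ?sqr_ge0 // divr_ge0 // ltW.
have v0 : 0 <= 1 / b * Y ^+ 2 by rewrite mulr_ge0 ?sqr_ge0 // divr_ge0 // ltW.
have w0 : 0 <= b * P ^+ 2 by rewrite mulr_ge0 ?sqr_ge0 // ltW.
have h0 := mulr_ge0 t0 w0.
have f1 := ler_wpM2r u0 C1; have f2 := ler_wpM2r u0 C2.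
have f3 := ler_wpM2r v0 C1; have f4 := ler_wpM2r (mulr_ge0 t0 w0) C1.
rewrite (_ : 2 / a * _ = 2 * (1 / a * X ^+ 2)); last by field.
rewrite (_ : 2 / b * _ = 2 * (1 / b * Y ^+ 2)); last by field.
move: e1 e2 e3 u0 v0 w0 f1 f2 f3 f4 gX.
move: (dotv _ _) (1 / a * _) (1 / b * _) => d u v.
lra.
Qed.
End Saddle.

(** * Validity and contraction of the Lyapunov function *)

Lemma psi_base_alex_core {R : realType} {dx dy : nat} (a b : R)
    (zs : 'rV[R]_dx * 'rV[R]_dy) (x g : 'rV[R]_dx) (y : 'rV[R]_dy) :
  a != 0 -> b != 0 ->
  lyapV a b zs x y + lyapV a b zs (x - a *: g) y - a * enorm g ^+ 2
  = alex_core zs a b x y g.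
Proof.
move=> a0 b0; rewrite /lyapV /alex_core (addrAC x) !sqr_enorm.
move: (x - zs.1) (y - zs.2) => X Y.
by rewrite !dotvE (dotvC X g); field; rewrite a0 b0.
Qed.

Theorem theorem5p1 (R : realType) (gamma delta : R)
    (hgamma : 1 < gamma) (hdelta : 1 < delta) :
  exists C : R, 0 < C /\
  forall (dx dy : nat) (mux muy Lx Ly Lxy : R),
    0 < mux -> mux <= Lx -> 0 < muy -> muy <= Ly -> 0 <= Lxy ->
  forall f : 'rV[R]_dx * 'rV[R]_dy -> R^o,
    function_class mux muy Lx Ly Lxy f ->
  forall zs : 'rV[R]_dx * 'rV[R]_dy, nash_equilibrium f zs ->
  forall alpha beta : R, 0 < alpha -> 0 < beta ->
    (alpha%:E <= step_bound C Lx mux muy Lxy)%E ->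
    (beta%:E <= step_bound C Ly muy mux Lxy)%E ->
  forall (x xt : nat -> 'rV[R]_dx) (y yt : nat -> 'rV[R]_dy),
    alex_gda f alpha beta gamma delta x xt y yt ->
  let Psi := psi_alex f mux muy Lxy alpha beta gamma delta zs x xt y yt in
  let r := Num.max (1 - alpha * mux) (1 - beta * muy) in
  (exists A : R, 0 < A /\
     forall k : nat, A * pair_enorm ((x k, y k) - zs) ^+ 2 <= Psi k) /\
  (forall k : nat, Psi k.+1 <= r * Psi k).
Proof.
exists (step_const gamma delta); split; first exact: step_const_gt0.
move=> dx dy mux muy Lx Ly Lxy mux0 muxL muy0 muyL Lxy0 f F zs N a b a0 b0 ha hb
  x xt y yt [yt0 alex] Psi r.
have C0 := step_const_gt0 hgamma hdelta.
have Lx0 : 0 < Lx by apply: lt_le_trans muxL.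
have Ly0 : 0 < Ly by apply: lt_le_trans muyL.
have [aLx aLxy] := step_boundP C0 Lx0 mux0 muy0 Lxy0 ha.
have [bLy bLxy] := step_boundP C0 Ly0 muy0 mux0 Lxy0 hb.
set m := Num.sqrt (muy / mux) in aLxy.
have m0 : 0 < m by rewrite sqrtr_gt0 divr_gt0.
(* The bound on b carries the square root of mux / muy, the inverse of [m]. *)
have {}bLxy : b * Lxy * m <= step_const gamma delta.
  have := ler_wpM2r (ltW m0) bLxy.
  by rewrite -[X in _ <= X]mulrA -[mux / muy]invf_div sqrtrV ?mulVf ?mulr1 ?gt_eqF //
    divr_ge0 ?ltW.
have C1 : step_const gamma delta < 1.
  have h := step_const_prod hgamma hdelta.
  have h1 : 1 <= gamma * delta by rewrite mulr_ege1 ?ltW.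
  have := ler_wpM2l (ltW C0) h1; lra.
have amux : a * mux < 1.
  by apply: le_lt_trans C1; apply: le_trans aLx; rewrite ler_wpM2l ?(ltW a0).
have bmuy : b * muy < 1.
  by apply: le_lt_trans C1; apply: le_trans bLy; rewrite ler_wpM2l ?(ltW b0).
(* This is the minimum of a mux and b muy. *)
pose rho := 1 - r.
have r0 : 0 <= r by rewrite le_max subr_ge0 (ltW amux).
have rho0 : 0 <= rho.
  by rewrite subr_ge0 ge_max !gerBl !mulr_ge0 ?ltW.
have rhoa : rho <= a * mux by rewrite lerBlDr addrC -lerBlDr le_max lexx.
have rhob : rho <= b * muy by rewrite lerBlDr addrC -lerBlDr le_max lexx orbT.
pose g k := gradx f (x k) (yt k).
pose h k := grady f (xt k.+1) (y k).
have xE k : x k.+1 = x k - a *: g k by case: (alex k).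
have xtE k : xt k.+1 = x k - (gamma * a) *: g k by case: (alex k).
have yE k : y k.+1 = y k + b *: h k by case: (alex k).
have ytE k : yt k.+1 = y k + (delta * b) *: h k by case: (alex k).
pose K := (gamma - 1) * (delta - 1) * (a * b * Lxy * m) / (1 - a * mux).
have K'0 : 0 <= (gamma - 1) * (delta - 1) * (a * b * Lxy * m).
  by rewrite 2?mulr_ge0 ?subr_ge0 ?(ltW hgamma) ?(ltW hdelta) ?mulr_ge0 ?(ltW a0) ?(ltW b0) ?(ltW m0).
have K0 : 0 <= K by rewrite divr_ge0 // subr_ge0 ltW.
pose K1 := K / (1 - b * muy).
have K10 : 0 <= K1 by rewrite divr_ge0 // subr_ge0 ltW.
have nz1 : 1 - a * mux != 0 by rewrite gt_eqF // subr_gt0.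
have nz2 : 1 - b * muy != 0 by rewrite gt_eqF // subr_gt0.
have Psi0 : Psi 0%N = alex_core zs a b (x 0%N) (y 0%N) (g 0%N) + K1 * dotv (g 0%N) (g 0%N).
  rewrite /Psi /psi_alex xE -/(g 0%N) psi_base_alex_core ?gt_eqF // sqr_enorm.
  by congr (_ + _ * _); rewrite /K1 /K -/m; field; rewrite nz1 nz2.
have PsiS k : Psi k.+1 = alex_core zs a b (x k.+1) (y k.+1) (g k.+1)
    + (delta - 1) * b * dotv (h k) (h k) + K * dotv (g k) (g k).
  rewrite /Psi /psi_alex (xE k.+1) -/(g k.+1) psi_base_alex_core ?gt_eqF // !sqr_enorm.
  by congr (_ + _ * _); rewrite /K -/m; field.
(* Measured from [y k.+1] instead of [y k], the extrapolation has factor delta - 1, as the one-step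
   lemmas require with [hp] the previous dual gradient. *)
have ytS k : yt k.+1 = y k.+1 + ((delta - 1) * b) *: h k.
  by rewrite ytE yE; apply/rowP => i; rewrite !mxE; ring.
have yt00 : yt 0%N = y 0%N + ((delta - 1) * b) *: 0 by rewrite scaler0 addr0.
have step k hp q := @alex_step R dx dy mux muy Lx Ly Lxy f F mux0 muxL muy0 muyL
  Lxy0 zs N gamma delta m a b q rho (x k) (y k) (yt k) hp hgamma hdelta m0 a0 b0
  aLx bLy aLxy bLxy amux rho0 rhoa rhob.
have lower k hp := @alex_core_ge R dx dy mux muy Lx Ly Lxy f F mux0 muxL
  Lxy0 zs N gamma delta m a b (x k) (y k) (yt k) hp hgamma hdelta m0 a0 b0
  aLx aLxy bLxy.
have dd n (u : 'rV[R]_n) (c : R) : 0 <= c -> 0 <= c * dotv u u.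
  by move=> c0; rewrite mulr_ge0 ?dotv_ge0.
split.
  exists (Num.min (1 / a) (1 / b)); split; first by rewrite lt_min !divr_gt0.
  move=> k.
  have le1 : Num.min (1 / a) (1 / b) * pair_enorm ((x k, y k) - zs) ^+ 2
      <= 1 / a * dotv (x k - zs.1) (x k - zs.1) + 1 / b * dotv (y k - zs.2) (y k - zs.2).
    rewrite /pair_enorm sqr_sqrtr ?addr_ge0 ?sqr_ge0 // !sqr_enorm mulrDr.
    by apply: lerD; rewrite ler_wpM2r ?dotv_ge0 // ge_min lexx ?orbT.
  apply: (le_trans le1).
  case: k {le1} => [|k].
    apply: (le_trans (lower _ _ yt00)).
    by rewrite Psi0 lerD // (_ : dotv 0 0 = 0) ?mulr0 ?dd // -(scale0r 0) dotvZl mul0r.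
  apply: (le_trans (lower _ _ (ytS k))).
  by rewrite PsiS lerDl dd.
have rE : r = 1 - rho by rewrite /rho opprB addrC subrK.
case=> [|k].
  rewrite PsiS Psi0.
  (* With zero past gradients the condition on [hp] reads 0 <= 0; the nonnegative [K1] term of Psi_0
     is then added on the right. *)
  have := step 0%N 0 0 yt00.
  rewrite -(scale0r 0) !dotvZr !mul0r /enorm dotvZr mul0r sqrtr0 !mul0r subr0.
  rewrite -/(g 0%N) -xE -xtE -/(h 0%N) -yE -ytE -/(g 1%N) expr0n mulr0 addr0 mulr0 addr0.
  move=> /(_ (lexx _)) /le_trans; apply.
  by rewrite -rE ler_wpM2l // lerDl dd.
rewrite !PsiS.
have := step k.+1 (h k) (enorm (g k)) (ytS k).
rewrite -/(g k.+1) -xE -xtE -/(h k.+1) -yE -ytE -/(g k.+2) sqr_enorm -rE; apply.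
(* The condition on [hp]: from (xt_{k+1}, y_k) to (x_{k+1}, yt_{k+1}) the shifts are (gamma - 1) a
   g_k and delta b h_k. *)
apply: dotv_perturb.
have := @enorm_sub_smooth _ _ _ _ (fun v u => grady f u v) _ _
  (delta * b * enorm (h k)) ((gamma - 1) * a * enorm (g k)) (y k) (yt k.+1)
  (xt k.+1) (x k.+1) (ltW Ly0) Lxy0
  (fun v v' u => fc_smooth_yy F u v v') (fun v u u' => fc_smooth_yx F u u' v).
apply; first by rewrite ytE (addrC (y k)) addrK enormZ // !mulr_ge0 // ltW //; lra.
rewrite (_ : x k.+1 - xt k.+1 = ((gamma - 1) * a) *: g k).
  by rewrite enormZ // mulr_ge0 ?subr_ge0 ?ltW.
by rewrite xE xtE; apply/rowP => i; rewrite !mxE; ring.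
Qed.
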